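(* Consider the lossless power flow equations (PF) of a power network $(\mathcal N,\mathcal E)$ (defined in the context). Assume that the network is radial and that there are no branches between $\mathsf{PQ}$ buses, i.e. $\mathcal E^{\ell\ell}=\emptyset$. Let $\mathsf D$ and $\mathsf S$ be the branch and nodal stiffness matrices and let $p$ be the vector of branch-wise active power flows. ($\mathsf S$ is diagonal in this case.) Define the nodal and branch stress measures $$\Delta_i = Q_i/\mathsf S_{ii}\ (i\in\mathcal N_L),\qquad \Gamma_i=\max_{j\in \mathsf{PV}(i)}|p_{ji}|/\mathsf D_{ji}\ (i\in\mathcal N_L),\qquad \Gamma_{ij}=|p_{ij}|/\mathsf D_{ij}\ ((i,j)\in\mathcal E^{gg}).$$ If $$\text{(C)}\qquad \max_{i\in\mathcal N_L}\ \left(\Delta_i+4\Gamma_i^2\right)<1,\qquad \max_{(i,j)\in\mathcal E^{gg}}\Gamma_{ij}<1,$$ then (PF) possesses a unique solution $(\theta,V_L)$ with $\mathsf{PQ}$ bus voltages $V_i$ and power angles $\eta_{ij}=\theta_i-\theta_j$ satisfying the bounds $$\text{(B)}\qquad v_{i,+}\le V_i/V_i^*\le 1\ (i\in\mathcal N_L),\qquad |\eta_{ji}|\le\gamma_i\ ((j,i)\in\mathcal E^{g\ell}),\qquad |\eta_{ij}|\le\gamma_{ij}\ ((i,j)\in\mathcal E^{gg}),$$ where $v_{i,+}\in(\tfrac12,1]$, $v_{i,-}\in[0,\tfrac1{\sqrt2})$, $\gamma_i\in[0,\tfrac\pi4)$ and $\gamma_{ij}\in[0,\tfrac\pi2)$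 are defined by $$v_{i,\pm}=\sqrt{\tfrac12\left(1-\tfrac{\Delta_i}{2}\pm\sqrt{1-(\Delta_i+4\Gamma_i^2)}\right)},\qquad \sin(\gamma_i)=\frac{\Gamma_i}{v_{i,+}},\qquad \sin(\gamma_{ij})=\Gamma_{ij}.$$ Moreover, the following statements hold. 1) (No medium-voltage or extra-high-voltage solutions.) There exist no solutions of (PF) with voltage magnitudes $V_i$ satisfying $$v_{i,-}<V_i/V_i^*<v_{i,+}\qquad\text{or}\qquad V_i/V_i^*>1$$ for any $i\in\mathcal N_L$. 2) (Necessity of conditions.) If $|\mathsf{PV}(i)|=1$ for each $i\in\mathcal N_L$, meaning every $\mathsf{PQ}$ bus has exactly one neighboring $\mathsf{PV}$ bus, then the conditions (C) are necessary and sufficient. Alternatively, if the network is loaded according to any of the loading profiles (i) $Q_L=\alpha\,\mathsf S\mathbf 1_n$ and $P=0$; (ii) $Q_L=0$ and $P=\frac{\alpha}{2}A\begin{pmatrix}\mathsf D_{g\ell}\mathbf 1\\ 0\end{pmatrix}$; (iii) $Q_L=0$ and $P=\alpha A\begin{pmatrix}0\\ \mathsf D_{gg}\mathbf 1\end{pmatrix}$; where $\alpha\in[0,1)$ and the block vectors are partitioned according to $\mathcal E=\mathcal E^{g\ell}\cup\mathcal E^{gg}$, then the conditions (C) are necessary and sufficient as functions of $\alpha$. In either case, the unique high-voltage solution satisfies the bounds (B) with equality sign.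
   Context: **Network.** $(\mathcal N,\mathcal E)$ is a finite connected graph whose branches (edges) have each been given a direction. The buses (nodes) are partitioned as $\mathcal N=\mathcal N_L\cup\mathcal N_G$, with $\mathcal N_L=\{1,\dots,n\}$ the loads ($\mathsf{PQ}$ buses) and $\mathcal N_G=\{n+1,\dots,n+m\}$ the generators ($\mathsf{PV}$ buses). The branches are partitioned as $\mathcal E=\mathcal E^{\ell\ell}\cup\mathcal E^{g\ell}\cup\mathcal E^{gg}$: branches between two loads, between a generator and a load (all oriented from generator to load), and between two generators; orientations within $\mathcal E^{\ell\ell}$ and $\mathcal E^{gg}$ are arbitrary. The network is radial if it contains no cycles. For $i\in\mathcal N_L$, $\mathsf{PV}(i)=\{k\in\mathcal N_G: (k,i)\in\mathcal E^{g\ell}\}$. **Susceptances.** Each branch $(i,j)\in\mathcal E$ is purely inductive with susceptance $b_{ij}=b_{ji}<0$ ($b_{ij}=0$ if $i,j$ are not joined by a branch), and each bus has a shunt susceptance $b_{\mathrm{shunt},i}\in\mathbb R$. The symmetric matrix $B\in\mathbb R^{(n+m)\times(n+m)}$ has $B_{ij}=-b_{ij}$ for $i\ne j$ and $B_{ii}=\sum_{j\ne i}b_{ij}+b_{\mathrm{shunt},i}$, with block partition $B=\begin{pmatrix} B_{LL} & B_{LG} \\ B_{GL} & B_{GG} \end{pmatrix}$ according to loads and generators. It is assumed that $B_{LL}$ is negative definite. **Power flow equations (PF).** Each bus has a voltage magnitude $V_i>0$ and a phase angle $\theta_i\in\mathbb S^1$. Given data: $P_i\in\mathbb R$ for all $i$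 (vector $P$), with $\sum_{i=1}^{n+m}P_i=0$; $V_i>0$ for $i\in\mathcal N_G$ (vector $V_G$); $Q_i\le0$ for $i\in\mathcal N_L$ (vector $Q_L$). Unknowns: $\theta=(\theta_1,\dots,\theta_{n+m})$ and $V_L=(V_1,\dots,V_n)\in\mathbb R^n_{>0}$. The equations are $$P_i=\sum_{j=1}^{n+m}V_iV_jB_{ij}\sin(\theta_i-\theta_j)\ (i\in\mathcal N_L\cup\mathcal N_G),\qquad Q_i=-\sum_{j=1}^{n+m}V_iV_jB_{ij}\cos(\theta_i-\theta_j)\ (i\in\mathcal N_L).$$ Uniqueness of $\theta$ is understood modulo adding a common constant to all angles; angle differences $\eta_{ij}=\theta_i-\theta_j$ are understood modulo $2\pi$ (with representatives in $(-\pi,\pi]$). **Branch flows.** $A\in\mathbb R^{(n+m)\times|\mathcal E|}$ is the oriented incidence matrix: in the column of branch $(i,j)$ the entry is $+1$ in row $i$ (sending end), $-1$ in row $j$ (receiving end), and $0$ elsewhere. For a radial network, $p=(A^{\mathsf T}A)^{-1}A^{\mathsf T}P$ is the unique vector with $P=Ap$; its entry for branch $(i,j)$ is $p_{ij}$. **Stiffness matrices.** The open-circuit load voltages are $V_L^*=-B_{LL}^{-1}B_{LG}V_G\in\mathbb R^n_{>0}$, with entries $V_i^*$, $i\in\mathcal N_L$; for $i\in\mathcal N_G$ put $V_i^*=V_i$. The branch stiffness matrix $\mathsf D$ is the $|\mathcal E|\times|\mathcal E|$ diagonal matrix with entry $\mathsf D_{ij}=V_i^*V_j^*B_{ij}$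 for branch $(i,j)$, with diagonal blocks $\mathsf D_{\ell\ell},\mathsf D_{g\ell},\mathsf D_{gg}$ according to the branch partition. The nodal stiffness matrix is $\mathsf S=\frac14\,\mathrm{diag}(V_L^* )\,B_{LL}\,\mathrm{diag}(V_L^* )$. $\mathbf 1$ (or $\mathbf 1_n$) denotes an all-ones vector of the appropriate length. A maximum over an empty set imposes no constraint.
   Formalization: In 1), medium voltages are excluded only if bus i has one PV neighbour or its feeding branches have |angle| ≤ π/2. In 2), (C) is necessary and sufficient for a solution with V_i/V_i* > v_{i,-} and all |angles| < π/2; arbitrary solutions force only the non-strict (C). *)

(* Defs.v *)
From HB Require Import structures.
From mathcomp Require Import all_boot all_order all_algebra.
From mathcomp Require Import all_classical all_reals all_analysis.

Set Implicit Arguments.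
Unset Strict Implicit.
Unset Printing Implicit Defensive.

Import Order.TTheory GRing.Theory Num.Theory.
Local Open Scope ring_scope.

(* Buses are 'I_(n + m): loads are lshift m i, generators are rshift n k.
   A branch (i, j) is directed from the sending end i to the receiving end j. *)
Record grid (R : realType) (n m : nat) := Grid {
  branches : {set 'I_(n + m) * 'I_(n + m)};
  susc : 'M[R]_(n + m);
  shunt : 'I_(n + m) -> R;
  Pinj : 'cV[R]_(n + m);
  VG : 'cV[R]_m;
  QL : 'cV[R]_n
}.

Section Grid.
Context {R : realType} {n m : nat}.
Implicit Types (g : grid R n m) (th : 'cV[R]_(n + m)) (VL : 'cV[R]_n).

Definition adj g : rel 'I_(n + m) :=
  fun i j => ((i, j) \in branches g) || ((j, i) \in branches g).

Definition Bmx g : 'M[R]_(n + m) :=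
  \matrix_(i, j) if i == j then \sum_(k | k != i) susc g i k + shunt g i
                 else - susc g i j.
Definition BLL g : 'M[R]_n := ulsubmx (Bmx g).
Definition BLG g : 'M[R]_(n, m) := ursubmx (Bmx g).

Record valid g : Prop := Valid {
  (* without generators a connected grid having no load-load branch is a single
     isolated load, for which the open-circuit voltage is 0 *)
  gen_exists : (0 < m)%N;
  (* each branch is directed one way only; in particular there are no loops *)
  branch_directed : forall i j,
    (i, j) \in branches g -> (j, i) \notin branches g;
  gen_to_load : forall (i : 'I_n) (k : 'I_m),
    (lshift m i, rshift n k) \notin branches g;
  grid_connected : forall i j, connect (adj g) i j;
  susc_sym : forall i j, susc g i j = susc g j i;
  susc_neg : forall i j, adj g i j -> susc g i j < 0;
  susc_eq0 : forall i j, ~~ adj g i j -> susc g i j = 0;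
  BLL_negdef : forall x : 'cV[R]_n, x != 0 -> (x^T *m BLL g *m x) 0 0 < 0;
  Pinj_balanced : \sum_i Pinj g i 0 = 0;
  VG_gt0 : forall k, 0 < VG g k 0;
  QL_le0 : forall i, QL g i 0 <= 0
}.

(* ucycle also accepts back-and-forth walks [:: i; j], which are not cycles of
   a simple graph. *)
Definition radial g : Prop :=
  forall c : seq 'I_(n + m), ucycle (adj g) c -> (size c <= 2)%N.

Definition no_load_load g : Prop :=
  forall i j : 'I_n, (lshift m i, lshift m j) \notin branches g.

Definition PV g (i : 'I_n) : {set 'I_m} :=
  [set k | (rshift n k, lshift m i) \in branches g].

(* Branch-indexed objects use the index type 'I_#|branches g|. *)
Definition snd_end g (e : 'I_#|branches g|) : 'I_(n + m) := (enum_val e).1.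
Definition rcv_end g (e : 'I_#|branches g|) : 'I_(n + m) := (enum_val e).2.

Definition is_load (i : 'I_(n + m)) : bool := (i < n)%N.
Definition gen_load g (e : 'I_#|branches g|) : bool :=
  ~~ is_load (snd_end e) && is_load (rcv_end e).
Definition gen_gen g (e : 'I_#|branches g|) : bool :=
  ~~ is_load (snd_end e) && ~~ is_load (rcv_end e).
(* e is a branch (j, i) with j in PV(i). *)
Definition feeds g (e : 'I_#|branches g|) (i : 'I_n) : bool :=
  gen_load e && (rcv_end e == lshift m i).

(* Angles in S^1 are represented by real lifts, and princ x is the
   representative of x modulo 2 pi in ]-pi, pi]. *)
Definition princ (x : R) : R :=
  x - 2 * pi * (Num.ceil ((x - pi) / (2 * pi)))%:~R.

Definition angle_diff g th (e : 'I_#|branches g|) : R :=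
  princ (th (snd_end e) 0 - th (rcv_end e) 0).

Definition pf_solution g th VL : Prop :=
  let V := col_mx VL (VG g) in
  [/\ forall i, 0 < VL i 0,
      forall i, Pinj g i 0 =
        \sum_j V i 0 * V j 0 * Bmx g i j * sin (th i 0 - th j 0)
    & forall i : 'I_n, let i' := lshift m i in
        QL g i 0 =
        - \sum_j V i' 0 * V j 0 * Bmx g i' j * cos (th i' 0 - th j 0)].

(* Equality of states in (S^1)^(n + m) * R^n, up to a common rotation. *)
Definition same_state th VL th' VL' : Prop :=
  VL = VL' /\
  exists c : R, forall i, exists k : int,
    th' i 0 = th i 0 + c + 2 * pi * k%:~R.

Definition has_unique (Sol : 'cV[R]_(n + m) -> 'cV[R]_n -> Prop) : Prop :=
  (exists th VL, Sol th VL) /\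
  (forall th VL th' VL', Sol th VL -> Sol th' VL' -> same_state th VL th' VL').

Definition incidence g : 'M[R]_(n + m, #|branches g|) :=
  \matrix_(i, e) ((i == snd_end e)%:R - (i == rcv_end e)%:R).

Definition flow g : 'cV[R]_#|branches g| :=
  let A := incidence g in invmx (A^T *m A) *m A^T *m Pinj g.

Definition VLstar g : 'cV[R]_n := - (invmx (BLL g) *m BLG g *m VG g).
Definition Vstar g : 'cV[R]_(n + m) := col_mx (VLstar g) (VG g).

Definition Dmx g : 'M[R]_#|branches g| :=
  diag_mx (\row_e (Vstar g (snd_end e) 0 * Vstar g (rcv_end e) 0
                   * Bmx g (snd_end e) (rcv_end e))).

Definition Smx g : 'M[R]_n :=
  4^-1 *: (diag_mx (VLstar g)^T *m BLL g *m diag_mx (VLstar g)^T).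

Definition Delta g (i : 'I_n) : R := QL g i 0 / Smx g i i.

Definition GammaE g (e : 'I_#|branches g|) : R := `|flow g e 0| / Dmx g e e.

(* The quotients are nonnegative, so the unit 0 of the iterated maximum does
   not affect its value. *)
Definition Gamma g (i : 'I_n) : R :=
  \big[Order.max/0]_(e : 'I_#|branches g| | feeds e i) GammaE e.

Definition condC g : Prop :=
  (forall i, Delta g i + 4 * Gamma g i ^+ 2 < 1) /\
  (forall e : 'I_#|branches g|, gen_gen e -> GammaE e < 1).

Definition condC_weak g : Prop :=
  (forall i, Delta g i + 4 * Gamma g i ^+ 2 <= 1) /\
  (forall e : 'I_#|branches g|, gen_gen e -> GammaE e <= 1).

Definition vplus g (i : 'I_n) : R :=
  Num.sqrt (2^-1 * (1 - Delta g i / 2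
                    + Num.sqrt (1 - (Delta g i + 4 * Gamma g i ^+ 2)))).
Definition vminus g (i : 'I_n) : R :=
  Num.sqrt (2^-1 * (1 - Delta g i / 2
                    - Num.sqrt (1 - (Delta g i + 4 * Gamma g i ^+ 2)))).

Definition gam g (i : 'I_n) : R := asin (Gamma g i / vplus g i).
Definition gamE g (e : 'I_#|branches g|) : R := asin (GammaE e).

(* vplus, vminus, gam and gamE lie in their announced ranges; there, the two
   equations on sines determine gam and gamE. *)
Definition ranges g : Prop :=
  (forall i, [/\ 2^-1 < vplus g i <= 1,
                 0 <= vminus g i < (Num.sqrt 2)^-1,
                 0 <= gam g i < pi / 4
               & sin (gam g i) = Gamma g i / vplus g i]) /\
  (forall e : 'I_#|branches g|, gen_gen e ->
     0 <= gamE e < pi / 2 /\ sin (gamE e) = GammaE e).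

Definition ratio g VL (i : 'I_n) : R := VL i 0 / VLstar g i 0.

Definition boundsB g th VL : Prop :=
  [/\ forall i, vplus g i <= ratio g VL i <= 1,
      forall (e : 'I_#|branches g|) i, feeds e i ->
        `|angle_diff th e| <= gam g i
    & forall e : 'I_#|branches g|, gen_gen e ->
        `|angle_diff th e| <= gamE e].

Definition boundsB_eq g th VL : Prop :=
  [/\ forall i, ratio g VL i = vplus g i,
      forall (e : 'I_#|branches g|) i, feeds e i ->
        `|angle_diff th e| = gam g i
    & forall e : 'I_#|branches g|, gen_gen e ->
        `|angle_diff th e| = gamE e].

(* A load fed by several generators, some of them at an angle beyond pi / 2,
   can have a medium voltage.  Example: one load with Q = 0 and no shunt, two
   generators with V = 1 joined to it by branches of susceptance -3 and -1,
   P = 0.  Then vminus = 0 and vplus = 1, but the state with the second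
   generator at angle pi, the other two buses at angle 0, and load voltage 1/2
   solves the power flow equations.  Medium voltages are therefore excluded
   for angles in [-pi/2, pi/2]; with a single feeding generator this
   restriction is not needed. *)
Definition regular_at g th (i : 'I_n) : Prop :=
  #|PV g i| = 1%N \/
  (forall e : 'I_#|branches g|, feeds e i -> `|angle_diff th e| <= pi / 2).

Definition no_medium_voltage g : Prop :=
  ~ exists th VL i, [/\ pf_solution g th VL, regular_at g th i
                      & vminus g i < ratio g VL i < vplus g i].

Definition no_extra_high_voltage g : Prop :=
  ~ exists th VL i, pf_solution g th VL /\ 1 < ratio g VL i.

(* High-voltage solutions are off the degenerate values V / V^* = vminus and
   |angle| = pi / 2, where they would merge with other solutions. *)
Definition hv_solution g th VL : Prop :=
  [/\ pf_solution g th VL,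
      forall i, vminus g i < ratio g VL i
    & forall e : 'I_#|branches g|, `|angle_diff th e| < pi / 2].

(* The strict condC is not necessary for mere existence of a solution, nor for
   a unique solution within boundsB: one load fed by one generator with
   Delta = 1/2 and 4 * Gamma ^ 2 = 1/2 has exactly one solution, with
   V / V^* = vplus = vminus.  It is necessary and sufficient for a unique
   high-voltage solution; its closure is necessary for any solution. *)
Definition condC_sharp g : Prop :=
  [/\ condC g <-> has_unique (hv_solution g),
      condC g <-> (exists th VL, hv_solution g th VL),
      (exists th VL, pf_solution g th VL) -> condC_weak g
    & forall th VL, hv_solution g th VL ->
        boundsB g th VL /\ boundsB_eq g th VL].

Definition ones_gl g : 'cV[R]_#|branches g| := \col_e (gen_load e)%:R.
Definition ones_gg g : 'cV[R]_#|branches g| := \col_e (gen_gen e)%:R.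

Definition profile_Q g (a : R) : Prop :=
  QL g = a *: (Smx g *m const_mx 1) /\ Pinj g = 0.
(* Dmx is diagonal, so Dmx *m ones_gl stacks D_gl 1 over 0. *)
Definition profile_gl g (a : R) : Prop :=
  QL g = 0 /\ Pinj g = (a / 2) *: (incidence g *m (Dmx g *m ones_gl g)).
Definition profile_gg g (a : R) : Prop :=
  QL g = 0 /\ Pinj g = a *: (incidence g *m (Dmx g *m ones_gg g)).

End Grid.

(* Main.v *)
Require Import Defs.
From HB Require Import structures.
From mathcomp Require Import all_boot all_order all_algebra.
From mathcomp Require Import all_classical all_reals all_analysis.
From mathcomp Require Import ring lra.

Set Implicit Arguments.
Unset Strict Implicit.
Unset Printing Implicit Defensive.

Import Order.TTheory GRing.Theory Num.Theory.
Import numFieldNormedType.Exports Defs.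
Local Open Scope ring_scope.

(** The network is a tree, so the nodal active power balance determines the flow
    of every branch ([incidence_flow], [incidence_inj]), and conversely any
    choice of angle differences on the branches comes from bus angles
    ([potential]).  As no branch joins two loads, the power flow equations thus
    decouple ([pf_solutionP]).  A branch between generators only fixes the sine
    of its angle.  A load with relative voltage v = V_i / V_i^* has to satisfy

      v ^ 2 + Delta / 4 = sum_e w_e v cos eta_e,
      (v cos eta_e) ^ 2 = v ^ 2 - Gamma_e ^ 2,

    where e ranges over its feeders and the w_e are convex weights.

    If all the Gamma_e equal Gamma, then x = v ^ 2 is a root of
    (x + Delta / 4) ^ 2 = x - Gamma ^ 2, whose discriminant is
    1 - Delta - 4 Gamma ^ 2 and whose roots are v_- ^ 2 and v_+ ^ 2.  In general
    this worst-case quadratic is compared with the true equation.  Every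
    v cos eta_e with nonnegative cosine is at least sqrt (x - Gamma ^ 2), so there
    is no solution strictly between the roots ([balanced_gap]), while the
    intermediate value theorem gives one in [v_+, 1] ([balanced_exists]).
    The latter is unique since the right-hand side has slope less than 1 in x
    above v_+ ^ 2 ([balanced_unique]), and v <= 1 always because the right-hand
    side is at most v ([balanced_le1]).

    For necessity, a single feeder per load as well as each of the loading
    profiles makes all feeders of a load equally stressed.  Then the worst case
    is the true equation, so the sign of the discriminant decides solvability and
    a high-voltage solution sits exactly at v_+ ([uniform_sharp]). *)

(** * Angles and arcsines *)

Section Angles.
Context {R : realType}.
Implicit Types (x t : R) (k : int).

Lemma sinD2pik x k : sin (x + 2 * pi * k%:~R) = sin x.
Proof.
have pos (y : R) (n : nat) : sin (y + 2 * pi * n%:R) = sin y.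
  rewrite -(periodicn (@sinD2pi R) n y); congr (sin (y + _)).
  by rewrite mulr_natr mulr_natl.
case: (intP k) => [|n|n]; first by rewrite mulr0 addr0.
  exact: pos.
by rewrite mulrNz mulrN -[LHS](pos _ n.+1) subrK.
Qed.

Lemma cosD2pik x k : cos (x + 2 * pi * k%:~R) = cos x.
Proof. by rewrite -!sinDpihalf addrAC sinD2pik. Qed.

Lemma sin_princ x : sin (princ x) = sin x.
Proof. by rewrite /princ -mulrN -intrN sinD2pik. Qed.

Lemma cos_princ x : cos (princ x) = cos x.
Proof. by rewrite /princ -mulrN -intrN cosD2pik. Qed.

(** On this interval the ceiling in the definition of [princ] is 0. *)
Lemma princ_id x : `|x| <= pi / 2 -> princ x = x.
Proof.
rewrite ler_norml => /andP[x1 x2]; have pi0 := pi_gt0 R.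
have d0 : 0 < 2 * pi :> R by rewrite mulr_gt0.
rewrite /princ; suff -> : Num.ceil ((x - pi) / (2 * pi)) = 0.
  by rewrite mulr0 subr0.
apply: ceil_def; rewrite ltr_pdivlMr // ler_pdivrMr // mul0r sub0r mulN1r.
by apply/andP; split; lra.
Qed.

Lemma angle_itv t : `|t| <= pi / 2 -> t \in `[(- (pi / 2)), (pi / 2)]%R.
Proof. by rewrite ler_norml in_itv. Qed.

Lemma norm_angleE t : `|t| <= pi / 2 -> `|t| = asin `|sin t|.
Proof.
move=> ht; have t0 := normr_ge0 t; have pi0 := pi_gt0 R.
have -> : `|sin t| = sin `|t|.
  have st0 : 0 <= sin `|t| by apply: sin_ge0_pi; apply/andP; split=> //; lra.
  rewrite -[RHS]ger0_norm //; have [_|_] := ger0P t => //.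
  by rewrite sinN normrN.
by rewrite sinK // in_itv /= ht andbT; lra.
Qed.

Lemma norm_le1_itv x : `|x| <= 1 -> x \in `[(-1), 1]%R.
Proof. by rewrite ler_norml in_itv. Qed.

Lemma norm_asin_le x : `|x| <= 1 -> `|asin x| <= pi / 2.
Proof. by rewrite !ler_norml => h; rewrite asin_geNpi2 ?asin_lepi2. Qed.

Lemma norm_asin x : `|x| <= 1 -> `|asin x| = asin `|x|.
Proof.
move=> hx; rewrite norm_angleE ?norm_asin_le //.
by rewrite asinK //; exact: norm_le1_itv.
Qed.

Lemma le_asin x t : 0 <= x -> x <= t -> t <= 1 -> asin x <= asin t.
Proof.
move=> x0 xt t1; have n (y : R) : 0 <= y -> y <= 1 -> `|y| <= 1.
  by move=> y0 y1; rewrite ger0_norm.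
have nx := n _ x0 (le_trans xt t1); have nt := n _ (le_trans x0 xt) t1.
rewrite leNgt; apply/negP => lt; move: xt; apply/negP; rewrite -ltNge.
rewrite -(asinK (norm_le1_itv nx)) -(asinK (norm_le1_itv nt)).
by rewrite ltr_sin // ?angle_itv // norm_asin_le.
Qed.

Lemma asin_ge0 x : 0 <= x <= 1 -> 0 <= asin x.
Proof.
move=> /andP[x0 x1]; have := @le_asin 0 x (lexx _) x0 x1.
apply: le_trans; rewrite -[in X in _ <= X](@sin0 R) sinK // in_itv /=.
by have := pi_gt0 R => ?; apply/andP; split; lra.
Qed.

Lemma cos_ge0_norm t : `|t| <= pi / 2 -> 0 <= cos t.
Proof. by rewrite ler_norml; exact: cos_ge0_pihalf. Qed.

Lemma sin_lt1 t : `|t| < pi / 2 -> `|sin t| < 1.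
Proof.
move=> ht; have c0 : 0 < cos t by apply: cos_gt0_pihalf; rewrite -ltr_norml.
have := cos2Dsin2 t; rewrite -(real_normK (num_real (sin t))) => h.
by rewrite -(@ltr_pXn2r _ 2) ?nnegrE // expr1n -h ltrDr exprn_gt0.
Qed.

Lemma asin_lt_pihalf x : 0 <= x < 1 -> 0 <= asin x < pi / 2.
Proof.
move=> /andP[x0 x1]; rewrite asin_ge0 ?x0 ?ltW //=.
by apply: asin_ltpi2; rewrite x1 andbT; lra.
Qed.

End Angles.

(** * The scalar problem of one load *)

Section LoadEquation.
Context {R : realType}.
Implicit Types (D G v x : R).

(** The high and the low voltage of a load with nodal stress D, all of whose
    feeders have stress G: their squares are the two roots x of
    (x + D / 4) ^ 2 = x - G ^ 2. *)
Definition highv D G : R :=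
  Num.sqrt (2^-1 * (1 - D / 2 + Num.sqrt (1 - (D + 4 * G ^+ 2)))).
Definition lowv D G : R :=
  Num.sqrt (2^-1 * (1 - D / 2 - Num.sqrt (1 - (D + 4 * G ^+ 2)))).

Lemma lt_sqr (x y : R) : 0 <= x -> 0 <= y -> (x < y) = (x ^+ 2 < y ^+ 2).
Proof. by move=> x0 y0; rewrite ltr_pXn2r. Qed.

Lemma le_sqr (x y : R) : 0 <= x -> 0 <= y -> (x <= y) = (x ^+ 2 <= y ^+ 2).
Proof. by move=> x0 y0; rewrite ler_pXn2r. Qed.

(** Here s is the square root of the discriminant.  The identity
    (1 - D / 2) ^ 2 - s ^ 2 = D ^ 2 / 4 + 4 * G ^ 2 shows that the smaller root
    is nonnegative, so that its square root [lowv] is a genuine one. *)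
Lemma sqr_roots D G : 0 <= D -> D + 4 * G ^+ 2 <= 1 ->
  exists s, [/\ 0 <= s, s ^+ 2 = 1 - (D + 4 * G ^+ 2),
    highv D G ^+ 2 = (1 - D / 2 + s) / 2 & lowv D G ^+ 2 = (1 - D / 2 - s) / 2].
Proof.
move=> D0 le1; exists (Num.sqrt (1 - (D + 4 * G ^+ 2))).
set s := Num.sqrt _; have s0 : 0 <= s by exact: sqrtr_ge0.
have s2 : s ^+ 2 = 1 - (D + 4 * G ^+ 2) by rewrite sqr_sqrtr // subr_ge0.
have G2 : 0 <= G ^+ 2 by exact: sqr_ge0.
have sD : s <= 1 - D / 2.
  have D2 : 0 <= D ^+ 2 by exact: sqr_ge0.
  rewrite le_sqr //; last by lra.
  by rewrite s2; lra.
by split=> //; rewrite /highv /lowv -/s sqr_sqrtr; lra.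
Qed.

Lemma highv_ge0 D G : 0 <= highv D G.
Proof. exact: sqrtr_ge0. Qed.

Lemma lowv_ge0 D G : 0 <= lowv D G.
Proof. exact: sqrtr_ge0. Qed.

Lemma highv_itv D G : 0 <= D -> D + 4 * G ^+ 2 < 1 ->
  2^-1 < highv D G <= 1.
Proof.
move=> D0 lt1; have [s [s0 s2 hv _]] := sqr_roots D0 (ltW lt1).
have G2 : 0 <= G ^+ 2 by exact: sqr_ge0.
have h0 := highv_ge0 D G.
have s1 : s <= 1 by rewrite le_sqr // s2; lra.
have hf : 0 <= 2^-1 :> R by lra.
by apply/andP; split; [rewrite (lt_sqr hf h0) hv; lra|rewrite le_sqr // hv; lra].
Qed.

Lemma lowv_itv D G : 0 <= D -> D + 4 * G ^+ 2 < 1 ->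
  0 <= lowv D G < (Num.sqrt 2)^-1.
Proof.
move=> D0 lt1; have [s [s0 s2 _ lv]] := sqr_roots D0 (ltW lt1).
rewrite lowv_ge0 lt_sqr ?lowv_ge0 ?invr_ge0 ?sqrtr_ge0 //.
have sp : 0 < s by rewrite lt_sqr // expr0n s2 /=; lra.
by rewrite lv exprVn sqr_sqrtr //; lra.
Qed.

Lemma lowv_lt_highv D G : 0 <= D -> D + 4 * G ^+ 2 < 1 ->
  lowv D G < highv D G.
Proof.
move=> D0 lt1; have [s [s0 s2 hv lv]] := sqr_roots D0 (ltW lt1).
have sp : 0 < s by rewrite lt_sqr // expr0n s2 /=; lra.
by rewrite lt_sqr ?highv_ge0 ?lowv_ge0 // hv lv; lra.
Qed.

(** At the high voltage, highv ^ 2 - G ^ 2 = ((1 + s) / 2) ^ 2 exceeds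
    G ^ 2 <= (1 - s ^ 2) / 4; hence the sine of the angle is below
    1 / sqrt 2, which is read off from cos (2 * angle) > 0. *)
Lemma angle_lt_pi4 D G : 0 <= D -> 0 <= G -> D + 4 * G ^+ 2 < 1 ->
  0 <= G / highv D G <= 1 /\ asin (G / highv D G) < pi / 4.
Proof.
move=> D0 G0 lt1; have [s [s0 s2 hv _]] := sqr_roots D0 (ltW lt1).
have /andP[h0 h1] := highv_itv D0 lt1.
have hp : 0 < highv D G by apply: lt_trans h0; rewrite invr_gt0.
have sp : 0 < s by rewrite lt_sqr // expr0n s2 /=; lra.
have q0 : 0 <= G / highv D G by rewrite divr_ge0 // ltW.
have q2 : 2 * (G / highv D G) ^+ 2 < 1.
  by rewrite expr_div_n mulrA ltr_pdivrMr ?exprn_gt0 // hv; nra.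
have q1 : G / highv D G <= 1 by rewrite le_sqr // expr1n; lra.
rewrite q0 q1; split=> //; set q := _ / _ in q0 q1 q2 *.
have nq : `|q| <= 1 by rewrite ger0_norm.
have pi0 := pi_gt0 R; have a1 := norm_asin_le nq.
have a0 : 0 <= asin q by apply: asin_ge0; rewrite q0.
rewrite ger0_norm // in a1.
suff : asin q + asin q < pi / 2 by lra.
rewrite -ltr_cos ?in_itv /=; [|by apply/andP; split; lra..].
rewrite cos_pihalf cosD; have /eqP := cos2Dsin2 (asin q).
rewrite -!expr2 eq_sym -subr_eq => /eqP <-.
by rewrite asinK ?norm_le1_itv //; lra.
Qed.

Section Balance.
Context (I : finType) (P : pred I) (w h : I -> R) (D G : R).
Hypothesis w_ge0 : forall e, P e -> 0 <= w e.
Hypothesis w_sum : \sum_(e | P e) w e = 1.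
Hypothesis h_itv : forall e, P e -> 0 <= h e <= G.
Hypothesis D_ge0 : 0 <= D.

(** The equations of one load fed by the branches e in P: v is its voltage
    relative to V^*, w e the share of e in the total feeder stiffness, h e the
    stress of e, and c e stands for v * cos (angle of e).  The active power of
    e fixes v * sin (angle of e) up to sign as h e, whence the value of
    c e ^ 2; the last equation is the reactive power balance. *)
Definition balanced v (c : I -> R) : Prop :=
  [/\ 0 < v, forall e, P e -> c e ^+ 2 = v ^+ 2 - h e ^+ 2
    & v ^+ 2 + D / 4 = \sum_(e | P e) w e * c e].

Lemma avg_le (c : I -> R) x : (forall e, P e -> c e <= x) ->
  \sum_(e | P e) w e * c e <= x.
Proof.
move=> cx; rewrite -[leRHS]mul1r -w_sum mulr_suml.
by apply: ler_sum => e Pe; rewrite ler_wpM2l ?w_ge0 ?cx.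
Qed.

Lemma avg_ge (c : I -> R) x : (forall e, P e -> x <= c e) ->
  x <= \sum_(e | P e) w e * c e.
Proof.
move=> cx; rewrite -[leLHS]mul1r -w_sum mulr_suml.
by apply: ler_sum => e Pe; rewrite ler_wpM2l ?w_ge0 ?cx.
Qed.

Lemma sqr_h e : P e -> 0 <= h e ^+ 2 <= G ^+ 2.
Proof.
by move=> /h_itv/andP[h0 hG]; rewrite sqr_ge0 ler_pXn2r // nnegrE (le_trans h0).
Qed.

(** As c e <= v, the balance gives v ^ 2 <= v. *)
Lemma balanced_le1 v c : balanced v c -> v <= 1.
Proof.
move=> [v0 c2 bal].
have : \sum_(e | P e) w e * c e <= v.
  apply: avg_le => e Pe; have := c2 e Pe; have /andP[? _] := sqr_h Pe.
  by move: v0; nra.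
rewrite -bal => le; rewrite -(ler_pM2l v0) mulr1 -expr2.
by have := D_ge0; lra.
Qed.

(** For nonnegative cosines each c e is at least sqrt (v ^ 2 - G ^ 2), so the
    balance forces (x + D / 4) ^ 2 >= x - G ^ 2 at x = v ^ 2, which fails strictly
    between the two roots. *)
Lemma balanced_gap v c : D + 4 * G ^+ 2 < 1 -> balanced v c ->
  (forall e, P e -> 0 <= c e) -> ~ lowv D G < v < highv D G.
Proof.
move=> lt1 [v0 c2 bal] c0; have [s [s0 s2 hv lv]] := sqr_roots D_ge0 (ltW lt1).
rewrite (lt_sqr (lowv_ge0 _ _) (ltW v0)) (lt_sqr (ltW v0) (highv_ge0 _ _)) hv lv.
move=> /andP[lo hi].
have lo' : 0 < v ^+ 2 - (1 - D / 2 - s) / 2 by rewrite subr_gt0.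
have hi' : 0 < (1 - D / 2 + s) / 2 - v ^+ 2 by rewrite subr_gt0.
have below : (v ^+ 2 + D / 4) ^+ 2 < v ^+ 2 - G ^+ 2.
  have := mulr_gt0 lo' hi'; lra.
have vG : G ^+ 2 <= v ^+ 2.
  by rewrite -subr_ge0; apply: le_trans (ltW below); exact: sqr_ge0.
have r0 := sqrtr_ge0 (v ^+ 2 - G ^+ 2).
have r2 : Num.sqrt (v ^+ 2 - G ^+ 2) ^+ 2 = v ^+ 2 - G ^+ 2.
  by rewrite sqr_sqrtr // subr_ge0.
have : Num.sqrt (v ^+ 2 - G ^+ 2) <= v ^+ 2 + D / 4.
  rewrite bal; apply: avg_ge => e Pe; have /andP[_ ?] := sqr_h Pe.
  by rewrite le_sqr ?c0 // c2 // r2; lra.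
rewrite le_sqr ?addr_ge0 ?divr_ge0 ?sqr_ge0 // r2.
by rewrite leNgt below.
Qed.

(** The right-hand side of the balance is a contraction in x = v ^ 2: above the
    larger root every c e is at least (1 + s) / 2 > 1 / 2, so that
    c' e - c e = (x' - x) / (c' e + c e) <= (x' - x) / (1 + s). *)
Lemma balanced_unique v c v' c' : D + 4 * G ^+ 2 < 1 ->
  balanced v c -> (forall e, P e -> 0 <= c e) -> highv D G <= v ->
  balanced v' c' -> (forall e, P e -> 0 <= c' e) -> highv D G <= v' -> v = v'.
Proof.
move=> lt1; have [s [s0 s2 hv _]] := sqr_roots D_ge0 (ltW lt1).
have sp : 0 < s by rewrite lt_sqr // expr0n s2 /=; lra.
have far u d e : balanced u d -> (forall e, P e -> 0 <= d e) ->
    highv D G <= u -> P e -> (1 + s) / 2 <= d e.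
  move=> [u0 d2 _] d0 hu Pe; have /andP[_ hG] := sqr_h Pe.
  have : highv D G ^+ 2 <= u ^+ 2 by rewrite -le_sqr ?highv_ge0 // ltW.
  by rewrite hv => ?; rewrite le_sqr ?d0 ?d2 //; lra.
have notlt u d u' d' : balanced u d -> (forall e, P e -> 0 <= d e) ->
    highv D G <= u -> balanced u' d' -> (forall e, P e -> 0 <= d' e) ->
    highv D G <= u' -> u' <= u.
  move=> b d0 hu b' d0' hu'; have [u0 d2 bal] := b; have [u0' d2' bal'] := b'.
  rewrite leNgt; apply/negP; rewrite lt_sqr ?(ltW u0) ?(ltW u0') // => lt.
  have : \sum_(e | P e) w e * (d' e - d e) <= (u' ^+ 2 - u ^+ 2) / (1 + s).
    apply: avg_le => e Pe; rewrite ler_pdivlMr; last by lra.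
    have f := far _ _ _ b d0 hu Pe; have f' := far _ _ _ b' d0' hu' Pe.
    have le : d e <= d' e by rewrite le_sqr ?d0 ?d0' // d2 // d2' //; lra.
    have := d2 e Pe; have := d2' e Pe.
    by have : 0 <= (d' e - d e) * (d' e + d e - (1 + s)); [apply: mulr_ge0; lra | lra].
  under eq_bigr => e _ do rewrite mulrBr.
  rewrite sumrB -bal -bal' ler_pdivlMr; last by lra.
  have : 0 < (u' ^+ 2 - u ^+ 2) * s by apply: mulr_gt0 => //; lra.
  by lra.
by move=> *; apply/eqP; rewrite eq_le; apply/andP; split; eauto.
Qed.

(** Intermediate value theorem in x = v ^ 2 on [highv ^ 2, 1].  At the lower end
    every square root is at least sqrt (x - G ^ 2) = x + D / 4, at the upper
    end every square root is at most 1. *)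
Lemma balanced_exists : 0 <= G -> D + 4 * G ^+ 2 < 1 ->
  exists v, highv D G <= v <= 1 /\
    balanced v (fun e => Num.sqrt (v ^+ 2 - h e ^+ 2)).
Proof.
move=> G0 lt1; have [s [s0 s2 hv _]] := sqr_roots D_ge0 (ltW lt1).
have /andP[hv0 hv1] := highv_itv D_ge0 lt1.
have hG : G ^+ 2 <= highv D G ^+ 2 by rewrite hv; nra.
pose f (x : R) : R := \sum_(e | P e) w e * Num.sqrt (x - h e ^+ 2) - x.
have fcont : continuous f.
  move=> x; apply: cvgB; last exact: cvg_id.
  apply: cvg_big => [|e _]; first exact: add_continuous.
  apply: cvgMl_tmp.
  apply: (@continuous_comp _ _ _ (fun x => x - h e ^+ 2) Num.sqrt).
    by apply: cvgB; [exact: cvg_id | exact: cvg_cst].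
  exact: sqrt_continuous.
have lo1 : highv D G ^+ 2 <= 1 by rewrite -[leRHS](expr1n _ 2) -le_sqr ?highv_ge0.
have flo : D / 4 <= f (highv D G ^+ 2).
  rewrite /f lerBrDr; apply: avg_ge => e Pe; have /andP[_ ?] := sqr_h Pe.
  have -> : D / 4 + highv D G ^+ 2 = (1 + s) / 2 by rewrite hv; lra.
  by rewrite le_sqr ?sqrtr_ge0 // 1?sqr_sqrtr; lra.
have fhi : f 1 <= D / 4.
  rewrite /f lerBlDr; apply: (@le_trans _ _ 1); last by have := D_ge0; lra.
  apply: avg_le => e Pe; have /andP[? _] := sqr_h Pe.
  by rewrite -[leRHS]sqrtr1 ler_wsqrtr //; lra.
have [||x] := @IVT R f _ _ (D / 4) lo1.
- exact: continuous_subspaceT.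
- by rewrite ge_min fhi orbT le_max flo.
rewrite in_itv /= => /andP[xlo xhi] fx.
have x0 : 0 < x by apply: lt_le_trans xlo; rewrite exprn_gt0 //; lra.
have x2 : Num.sqrt x ^+ 2 = x by rewrite sqr_sqrtr // ltW.
exists (Num.sqrt x); split.
  have r0 := sqrtr_ge0 x; apply/andP; split.
    by rewrite (le_sqr (highv_ge0 _ _) r0) x2.
  by rewrite (le_sqr r0 ler01) x2 expr1n.
split=> [|e Pe|]; rewrite ?sqrtr_gt0 // x2.
  by have /andP[_ ?] := sqr_h Pe; rewrite sqr_sqrtr //; lra.
by rewrite -fx /f addrC subrK.
Qed.

Section Uniform.
Hypothesis h_uniform : forall e, P e -> h e = G.

Lemma index_exists : exists e, P e.
Proof.
case: (pickP P) => [e Pe|P0]; first by exists e.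
by move/eqP: w_sum; rewrite big_pred0 // eq_sym oner_eq0.
Qed.

(** Even when some c e are negative, their average is at most
    sqrt (v ^ 2 - G ^ 2); the quadratic inequality that results needs a
    nonnegative discriminant. *)
Lemma uniform_weak v c : balanced v c -> D + 4 * G ^+ 2 <= 1.
Proof.
move=> [v0 c2 bal]; have [e0 Pe0] := index_exists.
have vG : 0 <= v ^+ 2 - G ^+ 2 by rewrite -(h_uniform Pe0) -c2 // sqr_ge0.
have : \sum_(e | P e) w e * c e <= Num.sqrt (v ^+ 2 - G ^+ 2).
  apply: avg_le => e Pe; apply: le_trans (ler_norm _) _.
  by rewrite le_sqr ?sqrtr_ge0 // real_normK ?num_real // sqr_sqrtr // c2 // h_uniform.
rewrite -bal le_sqr ?sqrtr_ge0 ?addr_ge0 ?divr_ge0 ?sqr_ge0 // sqr_sqrtr // => le.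
have := sqr_ge0 (v ^+ 2 - (1 - D / 2) / 2); lra.
Qed.

(** When all c e are equal the balance is the quadratic equation itself, so
    v is one of the two roots.  Being above the smaller root excludes that root
    as well as a double root. *)
Lemma uniform_high v c : balanced v c -> (forall e, P e -> 0 <= c e) ->
  lowv D G < v -> D + 4 * G ^+ 2 < 1 /\ v = highv D G.
Proof.
move=> b c0 lo; have [v0 c2 bal] := b; have [e0 Pe0] := index_exists.
have [s [s0 s2 hv lv]] := sqr_roots D_ge0 (uniform_weak b).
have avg : v ^+ 2 + D / 4 = c e0.
  apply/eqP; rewrite eq_le bal avg_le ?avg_ge // => e Pe;
  by rewrite le_sqr ?c0 // !c2 // !h_uniform.
have root : (v ^+ 2 + D / 4) ^+ 2 = v ^+ 2 - G ^+ 2.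
  by rewrite avg c2 // h_uniform.
have lo2 : lowv D G ^+ 2 < v ^+ 2 by rewrite -lt_sqr ?lowv_ge0 // ltW.
have : (v ^+ 2 - lowv D G ^+ 2) * (v ^+ 2 - highv D G ^+ 2) = 0.
  by rewrite hv lv; lra.
move/eqP; rewrite mulf_eq0 !subr_eq0 gt_eqF //= => /eqP vhv.
split.
  have : 0 < s by move: lo2; rewrite vhv hv lv; lra.
  by rewrite lt_sqr // s2 expr0n /=; lra.
by apply/eqP; rewrite -(@eqrXn2 _ 2) ?highv_ge0 ?(ltW v0) // vhv.
Qed.

End Uniform.

End Balance.
End LoadEquation.

(** * Flows and potentials on a tree *)

(** If every end of every edge had a second neighbour, a simple path could be
    prolonged at its head forever: the new neighbour lies off the path, since
    otherwise it would close a cycle of length at least 3.  This contradicts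
    the finiteness of T. *)
Lemma acyclic_leaf (T : finType) (e : rel T) :
    symmetric e -> irreflexive e ->
    (forall c, ucycle e c -> (size c <= 2)%N) ->
  (exists x y, e x y) -> exists x y, e x y /\ forall z, e x z -> z = y.
Proof.
move=> eC eI acyc [x0 [y0 e0]]; apply: contrapT => noleaf.
have ext x y : e x y -> exists2 z, z != y & e x z.
  move=> exy; apply: contrapT => nz; apply: noleaf; exists x, y; split=> // z exz.
  by apply: contrapT => /eqP zy; apply: nz; exists z.
have long k : exists x y p, [/\ size p = k, path e x (y :: p) & uniq (x :: y :: p)].
  elim: k => [|k [x [y [p [sp pxy uxy]]]]].
    exists x0, y0, [::]; split=> //=; first by rewrite e0.
    by rewrite inE andbT; apply: contraTneq e0 => ->; rewrite eI.
  have exy : e x y by case/andP: pxy.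
  have [z zy exz] := ext x y exy.
  have zx : z != x by apply: contraTneq exz => ->; rewrite eI.
  have [zp|zp] := boolP (z \in p); last first.
    exists z, x, (y :: p); split; first by rewrite /= sp.
      by rewrite /= eC exz.
    by rewrite cons_uniq uxy andbT !inE !negb_or zx zy.
  case/splitPr: zp sp pxy uxy => p1 p2 _ pxy uxy.
  have : ucycle e (x :: y :: rcons p1 z); last first.
    by move/acyc; rewrite /= size_rcons.
  move: pxy uxy; rewrite -cat_rcons -!cat_cons => pxy uxy.
  rewrite /ucycle (subseq_uniq (prefix_subseq _ p2) uxy) andbT /=.
  move: pxy; rewrite cat_path => /andP[/= /andP[exy' pz] _].
  by rewrite exy' rcons_path pz last_rcons eC exz.
have [x [y [p [sp _ u]]]] := long #|T|.
have := max_card (mem (x :: y :: p)); rewrite (card_uniqP u) /= sp.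
by rewrite ltnNge leqnSn.
Qed.

Section Network.
Context {R : realType} {n m : nat} (g : grid R n m).
Hypothesis g_valid : valid g.

Lemma adj_irr : irreflexive (adj g).
Proof.
move=> i; rewrite /adj orbb; apply/negP => ii.
by have := branch_directed g_valid ii; rewrite ii.
Qed.

Lemma branchP (e : 'I_#|branches g|) : (snd_end e, rcv_end e) \in branches g.
Proof. by rewrite /snd_end /rcv_end -surjective_pairing enum_valP. Qed.

Lemma branch_index i j : (i, j) \in branches g ->
  exists e : 'I_#|branches g|, snd_end e = i /\ rcv_end e = j.
Proof.
move=> ij; exists (enum_rank_in ij (i, j)).
by rewrite /snd_end /rcv_end enum_rankK_in.
Qed.

Lemma branch_inj (e e' : 'I_#|branches g|) :
  snd_end e = snd_end e' -> rcv_end e = rcv_end e' -> e = e'.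
Proof.
move=> s r; apply: enum_val_inj.
by rewrite [LHS]surjective_pairing [RHS]surjective_pairing; congr (_, _).
Qed.

Lemma connected_ind (Q : 'I_(n + m) -> Prop) i0 :
  Q i0 -> (forall i j, adj g i j -> Q i -> Q j) -> forall i, Q i.
Proof.
move=> Q0 step i; have /connectP[p] := grid_connected g_valid i0 i.
elim: p i0 Q0 => [|j p ih] i0 Q0 /=; first by move=> _ ->.
by move=> /andP[a pp] l; apply: ih pp l; apply: step a Q0.
Qed.

Lemma sum_branches (F : 'I_(n + m) -> 'I_(n + m) -> R) :
  \sum_(e < #|branches g|) F (snd_end e) (rcv_end e) =
  \sum_i \sum_j if (i, j) \in branches g then F i j else 0.
Proof.
rewrite pair_big /=.
transitivity (\sum_(p in branches g) F p.1 p.2); first by rewrite [RHS]big_enum_val.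
by rewrite big_mkcond; apply: eq_bigr => -[i j] _.
Qed.

Lemma incidence_trE (th : 'cV[R]_(n + m)) e :
  ((incidence g)^T *m th) e 0 = th (snd_end e) 0 - th (rcv_end e) 0.
Proof.
rewrite !mxE; under eq_bigr => i _ do rewrite !mxE mulrBl.
rewrite sumrB; congr (_ - _).
  rewrite (bigD1 (snd_end e)) //= eqxx mul1r big1 ?addr0 // => i /negPf->.
  by rewrite mul0r.
rewrite (bigD1 (rcv_end e)) //= eqxx mul1r big1 ?addr0 // => i /negPf->.
by rewrite mul0r.
Qed.

Lemma sum_incidence (q : 'cV[R]_#|branches g|) :
  \sum_i (incidence g *m q) i 0 = 0.
Proof.
have -> : \sum_i (incidence g *m q) i 0 =
    ((incidence g *m q)^T *m const_mx 1 : 'M[R]_(1, 1)) 0 0.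
  by rewrite mxE; apply: eq_bigr => i _; rewrite !mxE mulr1.
rewrite trmx_mul -mulmxA (_ : _ *m const_mx 1 = 0) ?mulmx0 ?mxE //.
by apply/colP => e; rewrite incidence_trE !mxE subrr.
Qed.

(** Turns a sum over directed branches into a sum over neighbours: the entry
    +1 at the sending end and -1 at the receiving end are absorbed by the
    antisymmetry of f. *)
Lemma incidence_mulE (f : 'I_(n + m) -> 'I_(n + m) -> R) i :
    (forall a b, f a b = - f b a) -> (forall a b, ~~ adj g a b -> f a b = 0) ->
  (incidence g *m \col_e f (snd_end e) (rcv_end e)) i 0 = \sum_j f i j.
Proof.
move=> fN f0; rewrite mxE.
pose F a b := ((i == a)%:R - (i == b)%:R) * f a b.
under eq_bigr => e _ do rewrite !mxE -/(F _ _).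
rewrite sum_branches.
pose G a b := if (a, b) \in branches g then f a b else 0.
transitivity (\sum_a \sum_b ((i == a)%:R * G a b - (i == b)%:R * G a b)).
  apply: eq_bigr => a _; apply: eq_bigr => b _; rewrite /G /F.
  by case: ifP => _; rewrite ?mulr0 ?subrr ?mulrBl.
under eq_bigr => a _ do rewrite sumrB.
rewrite sumrB exchange_big /= [X in _ - X]exchange_big /=.
have pick (H : 'I_(n + m) -> R) : \sum_a (i == a)%:R * H a = H i.
  rewrite (bigD1 i) //= eqxx mul1r big1 ?addr0 // => a.
  by rewrite eq_sym => /negPf->; rewrite mul0r.
rewrite [X in _ - X](_ : _ = \sum_a G a i); last first.
  by rewrite exchange_big; apply: eq_bigr => a _; exact: (pick (G a)).
rewrite -sumrB; apply: eq_bigr => j _; rewrite (pick (G^~ j)) /G.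
have [ij|ij] := boolP ((i, j) \in branches g).
  by rewrite (negPf (branch_directed g_valid ij)) subr0.
have [ji|ji] := boolP ((j, i) \in branches g); first by rewrite sub0r -fN.
by rewrite subrr f0 // /adj negb_or ij.
Qed.

Lemma unitmx_inj k (M : 'M[R]_k) :
  (forall x : 'cV_k, M *m x = 0 -> x = 0) -> M \in unitmx.
Proof.
move=> inj; rewrite -unitmx_tr -row_free_unit -kermx_eq0; apply/eqP.
apply/row_matrixP => i; rewrite row0; set u := row i _.
have : u *m M^T = 0 by apply/sub_kermxP; rewrite row_sub.
by move/(congr1 trmx); rewrite trmx_mul trmxK trmx0 => /inj/(congr1 trmx);
  rewrite trmxK trmx0.
Qed.

Section Radial.
Hypothesis g_radial : radial g.

(** The branches where q is nonzero form an acyclic graph.  If it had a branch,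
    it would have a leaf; the row of that leaf has a single nonzero term. *)
Lemma incidence_inj (q : 'cV[R]_#|branches g|) : incidence g *m q = 0 -> q = 0.
Proof.
move=> Aq0; apply/eqP; apply: contrapT => /negP q0.
pose r (i j : 'I_(n + m)) := [exists e : 'I_#|branches g|, (q e 0 != 0) &&
  ((enum_val e == (i, j)) || (enum_val e == (j, i)))].
have rP i j : reflect (exists2 e : 'I_#|branches g|, q e 0 != 0 &
    enum_val e = (i, j) \/ enum_val e = (j, i)) (r i j).
  apply: (iffP existsP) => -[e].
    by move=> /andP[qe /orP[]/eqP ee]; exists e => //; [left|right].
  by move=> qe ee; exists e; rewrite qe; case: ee => ->; rewrite eqxx ?orbT.
have radj i j : r i j -> adj g i j.
  by move=> /rP[e _ ee]; have := enum_valP e; rewrite /adj;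
    case: ee => -> ->; rewrite ?orbT.
have rC : symmetric r.
  by move=> i j; apply/rP/rP => -[e qe ee]; exists e => //; case: ee; auto.
have rI : irreflexive r.
  by move=> i; apply/negbTE/negP => h; have := radj i i h; rewrite adj_irr.
have acyc c : ucycle r c -> (size c <= 2)%N.
  move=> /andP[cy u]; apply: g_radial; rewrite /ucycle u andbT.
  by apply: sub_cycle cy => a b; exact: radj.
have [|i [j [/rP[e qe ee] uj]]] := acyclic_leaf rC rI acyc.
  have /cV0Pn[e qe] := q0.
  exists (snd_end e), (rcv_end e); apply/rP; exists e => //; left.
  exact: surjective_pairing.
have ij : i != j.
  apply/eqP => ij; have : adj g i j by apply: radj; apply/rP; exists e.
  by rewrite ij adj_irr.
have same e' : q e' 0 != 0 -> (i == snd_end e') || (i == rcv_end e') -> e' = e.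
  move=> qe' ie'.
  have ends : enum_val e' = (i, j) \/ enum_val e' = (j, i).
    have E : enum_val e' = (snd_end e', rcv_end e') by exact: surjective_pairing.
    case/orP: ie' => /eqP ie'; [left|right]; rewrite E ie'; congr (_, _);
      apply: uj; apply/rP; exists e' => //; rewrite E ie'; [left|right] => //.
  have := enum_valP e'; have := enum_valP e.
  case: ee => ee; case: ends => ends; rewrite ee ends => h h'.
  - by apply: enum_val_inj; rewrite ee ends.
  - by have := branch_directed g_valid h; rewrite h'.
  - by have := branch_directed g_valid h; rewrite h'.
  - by apply: enum_val_inj; rewrite ee ends.
have := congr1 (fun M : 'cV[R]_(n + m) => M i 0) Aq0; rewrite !mxE (bigD1 e) //= big1.
  rewrite addr0 mxE => /eqP; rewrite mulf_eq0 (negPf qe) orbF.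
  rewrite /snd_end /rcv_end.
  by case: ee => ->; rewrite /= eqxx (negPf ij) ?subr0 ?sub0r ?oppr_eq0 oner_eq0.
move=> e' e'e; rewrite mxE; have [->|qe'] := eqVneq (q e' 0) 0; first by rewrite mulr0.
have : ~~ ((i == snd_end e') || (i == rcv_end e')).
  by apply: contra e'e => ie'; apply/eqP; exact: same.
by rewrite negb_or => /andP[/negPf-> /negPf->]; rewrite subr0 mul0r.
Qed.

Lemma gram_unit : (incidence g)^T *m incidence g \in unitmx.
Proof.
apply: unitmx_inj => x Mx0; apply: incidence_inj.
have : ((incidence g *m x)^T *m (incidence g *m x)) 0 0 = 0.
  by rewrite trmx_mul -mulmxA (mulmxA _ _ x) Mx0 mulmx0 mxE.
set y := incidence g *m x; rewrite mxE => /eqP.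
rewrite psumr_eq0 => [/allP y0|i _]; last by rewrite mxE -expr2 sqr_ge0.
apply/colP => i; have := y0 i (mem_index_enum _).
by rewrite !mxE -expr2 sqrf_eq0 => /eqP.
Qed.

(** Kirchhoff's voltage law is void on a tree.  A solution of A^T th = eta is
    th = A (A^T A)^-1 eta. *)
Lemma potential (eta : 'I_#|branches g| -> R) :
  exists th : 'cV[R]_(n + m),
    forall e, th (snd_end e) 0 - th (rcv_end e) 0 = eta e.
Proof.
pose th := incidence g *m invmx ((incidence g)^T *m incidence g) *m \col_e eta e.
exists th => e; rewrite -incidence_trE /th !mulmxA mulmxV ?gram_unit //.
by rewrite mul1mx mxE.
Qed.

(** The residual r = P - A p of the least-squares flow is orthogonal to every
    branch, hence constant on the connected grid.  Its entries sum to 0 because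
    the injections are balanced, so it vanishes. *)
Lemma incidence_flow : incidence g *m flow g = Pinj g.
Proof.
pose r := Pinj g - incidence g *m flow g.
have Ar : (incidence g)^T *m r = 0.
  by rewrite /r /flow mulmxBr !mulmxA mulmxV ?gram_unit // mul1mx subrr.
have rE (e : 'I_#|branches g|) : r (snd_end e) 0 = r (rcv_end e) 0.
  by apply: subr0_eq; have := incidence_trE r e; rewrite Ar mxE.
have radj i j : adj g i j -> r i 0 = r j 0.
  by rewrite /adj => /orP[] /branch_index[e [<- <-]]; rewrite rE.
suff r0 : r = 0 by apply/eqP; rewrite eq_sym -subr_eq0 -/r r0.
have rsum : \sum_i r i 0 = 0.
  under eq_bigr => i _ do rewrite /r !mxE.
  rewrite sumrB (Pinj_balanced g_valid) sub0r; apply/eqP; rewrite oppr_eq0; apply/eqP.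
  by rewrite -[RHS](sum_incidence (flow g)); apply: eq_bigr => i _; rewrite !mxE.
apply/colP => i; rewrite [RHS]mxE.
have rconst j : r j 0 = r i 0.
  by move: j; apply: (@connected_ind (fun j => r j 0 = r i 0) i) => // a b /radj ->.
move: rsum; under eq_bigr => j _ do rewrite rconst.
rewrite sumr_const card_ord => /eqP; rewrite mulrn_eq0 => /orP[|/eqP //].
by rewrite addn_eq0 (eqn0Ngt m) (gen_exists g_valid) andbF.
Qed.

Lemma flow_unique q : incidence g *m q = Pinj g -> q = flow g.
Proof.
move=> Aq; apply/eqP; rewrite -subr_eq0; apply/eqP/incidence_inj.
by rewrite mulmxBr Aq incidence_flow subrr.
Qed.

End Radial.
End Network.

(** * Decoupling of the power flow equations *)

Section Reduction.
Context {R : realType} {n m : nat} (g : grid R n m).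
Hypothesis g_valid : valid g.
Hypothesis g_noll : no_load_load g.

Local Notation edge := 'I_#|branches g|.
Local Notation ld := (lshift m).
Local Notation gn := (rshift n).

Lemma is_load_lshift (i : 'I_n) : is_load (ld i).
Proof. exact: (ltn_ord i). Qed.

Lemma is_load_rshift (k : 'I_m) : is_load (gn k) = false.
Proof. by rewrite /is_load ltnNge /= leq_addr. Qed.

Lemma snd_end_gen (e : edge) : exists k, snd_end e = gn k.
Proof.
have := branchP e; case: (split_ordP (snd_end e)) => [i ->|k ->]; last by exists k.
case: (split_ordP (rcv_end e)) => [j ->|k ->].
  by rewrite (negPf (g_noll i j)).
by rewrite (negPf (gen_to_load g_valid i k)).
Qed.

Lemma gen_loadE (e : edge) : gen_load e = is_load (rcv_end e).
Proof.
by rewrite /gen_load; have [k ->] := snd_end_gen e; rewrite is_load_rshift.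
Qed.

Lemma gen_genE (e : edge) : gen_gen e = ~~ is_load (rcv_end e).
Proof.
by rewrite /gen_gen; have [k ->] := snd_end_gen e; rewrite is_load_rshift.
Qed.

Lemma feedsE (e : edge) i : feeds e i = (rcv_end e == ld i).
Proof.
rewrite /feeds gen_loadE; apply/andP/idP => [[]//|/eqP ->].
by rewrite is_load_lshift.
Qed.

Lemma edge_cases (e : edge) : (exists i, feeds e i) \/ gen_gen e.
Proof.
rewrite gen_genE; case: (split_ordP (rcv_end e)) => [i ri|k ->].
  by left; exists i; rewrite feedsE ri.
by right; rewrite is_load_rshift.
Qed.

Lemma adj_load_load i j : ~~ adj g (ld i) (ld j).
Proof. by rewrite /adj negb_or !g_noll. Qed.

Lemma adj_load_gen i k : adj g (ld i) (gn k) = (k \in PV g i).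
Proof. by rewrite /adj inE (negPf (gen_to_load g_valid i k)). Qed.

Lemma Bmx_off i j : i != j -> Bmx g i j = - susc g i j.
Proof. by move=> /negPf ij; rewrite mxE ij. Qed.

Lemma Bmx_sym i j : Bmx g i j = Bmx g j i.
Proof.
have [->//|ij] := eqVneq i j.
by rewrite (Bmx_off ij) Bmx_off 1?(susc_sym g_valid) // eq_sym.
Qed.

Lemma Bmx_gt0 i j : adj g i j -> 0 < Bmx g i j.
Proof.
move=> ij; rewrite Bmx_off ?oppr_gt0 ?(susc_neg g_valid) //.
by apply: contraTneq ij => ->; rewrite adj_irr.
Qed.

Lemma Bmx_eq0 i j : i != j -> ~~ adj g i j -> Bmx g i j = 0.
Proof. by move=> ij nij; rewrite Bmx_off // (susc_eq0 g_valid) ?oppr0. Qed.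

Lemma BLLE i j : BLL g i j = Bmx g (ld i) (ld j).
Proof. by rewrite !mxE. Qed.

Lemma BLGE i k : BLG g i k = Bmx g (ld i) (gn k).
Proof. by rewrite !mxE. Qed.

Lemma BLL_off i j : i != j -> BLL g i j = 0.
Proof.
by move=> ij; rewrite BLLE Bmx_eq0 ?adj_load_load // (inj_eq (@lshift_inj _ _)).
Qed.

Lemma BLL_diag : BLL g = diag_mx (\row_i BLL g i i).
Proof.
apply/matrixP => i j; rewrite [RHS]mxE [X in X *+ _]mxE.
by have [->//|ij] := eqVneq i j; rewrite BLL_off.
Qed.

Lemma BLL_lt0 i : BLL g i i < 0.
Proof.
have := @BLL_negdef _ _ _ g g_valid (delta_mx i 0).
rewrite trmx_delta -rowE -colE [X in X < 0]mxE mxE; apply.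
by apply/eqP => /matrixP/(_ i 0); rewrite !mxE !eqxx => /eqP; rewrite oner_eq0.
Qed.

Lemma sum_feeds (F : 'I_(n + m) -> R) i :
  \sum_(e : edge | feeds e i) F (snd_end e) = \sum_(k in PV g i) F (gn k).
Proof.
pose G (a b : 'I_(n + m)) := if b == ld i then F a else 0.
transitivity (\sum_(e : edge) G (snd_end e) (rcv_end e)).
  by rewrite big_mkcond; apply: eq_bigr => e _; rewrite feedsE.
rewrite sum_branches big_split_ord /= big1 ?add0r => [|j _]; last first.
  rewrite big1 // => b _; case: ifP => // jb; rewrite /G; case: eqP => // bi.
  by rewrite bi (negPf (g_noll j i)) in jb.
rewrite [RHS]big_mkcond; apply: eq_bigr => k _; rewrite inE.
rewrite (bigD1 (ld i)) //= /G eqxx big1 ?addr0 // => b /negPf->.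
by rewrite if_same.
Qed.

(** The first step of a path from the load to any generator ends at a
    generator. *)
Lemma feeder_exists i : exists e : edge, feeds e i.
Proof.
pose k0 := Ordinal (gen_exists g_valid).
have /connectP[[|j p] /=] := grid_connected g_valid (ld i) (gn k0).
  by move=> _ /(congr1 is_load); rewrite is_load_lshift is_load_rshift.
case: (split_ordP j) => [j' ->|k ->]; first by rewrite (negPf (adj_load_load i j')).
rewrite adj_load_gen inE => /andP[/branch_index[e [_ re]] _] _.
by exists e; rewrite feedsE re.
Qed.

Lemma VLstar_eq i :
  - BLL g i i * VLstar g i 0 =
  \sum_(k in PV g i) Bmx g (ld i) (gn k) * VG g k 0.
Proof.
have Bunit : BLL g \in unitmx.
  apply: unitmx_inj => x Bx0; apply: contrapT => /eqP x0.
  by have := BLL_negdef g_valid x0; rewrite -mulmxA Bx0 mulmx0 mxE ltxx.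
have : BLL g *m VLstar g = - (BLG g *m VG g).
  by rewrite /VLstar mulmxN !mulmxA mulmxV // mul1mx.
rewrite [in LHS]BLL_diag mul_diag_mx => /matrixP/(_ i 0).
rewrite !mxE mulNr => ->; rewrite opprK [RHS]big_mkcond; apply: eq_bigr => k _.
case: ifPn => [_|]; first by rewrite BLGE.
by rewrite -adj_load_gen BLGE => nk; rewrite Bmx_eq0 ?mul0r // eq_lrshift.
Qed.

Lemma VLstar_gt0 i : 0 < VLstar g i 0.
Proof.
rewrite -(pmulr_rgt0 _ (_ : 0 < - BLL g i i)) ?oppr_gt0 ?BLL_lt0 // VLstar_eq.
have term k : k \in PV g i -> 0 < Bmx g (ld i) (gn k) * VG g k 0.
  by rewrite -adj_load_gen => /Bmx_gt0 ?; rewrite mulr_gt0 ?(VG_gt0 g_valid).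
have [e ei] := feeder_exists i; have [k sk] := snd_end_gen e.
have kPV : k \in PV g i.
  by move: ei; rewrite feedsE inE -sk => /eqP <-; exact: branchP.
rewrite (bigD1 k) //= ltr_wpDr ?term // sumr_ge0 // => k' /andP[k'PV _].
exact: ltW (term _ k'PV).
Qed.

Lemma Vstar_load i : Vstar g (ld i) 0 = VLstar g i 0.
Proof. exact: col_mxEu. Qed.

Lemma Vstar_gen k : Vstar g (gn k) 0 = VG g k 0.
Proof. exact: col_mxEd. Qed.

Lemma Vstar_gt0 j : 0 < Vstar g j 0.
Proof.
case: (split_ordP j) => [i ->|k ->]; first by rewrite Vstar_load VLstar_gt0.
by rewrite Vstar_gen (VG_gt0 g_valid).
Qed.

Lemma Dmx_diagE (e : edge) : Dmx g e e =
  Vstar g (snd_end e) 0 * Vstar g (rcv_end e) 0 * Bmx g (snd_end e) (rcv_end e).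
Proof. by rewrite [LHS]mxE eqxx [LHS]mxE. Qed.

Lemma Dmx_gt0 (e : edge) : 0 < Dmx g e e.
Proof.
rewrite Dmx_diagE !mulr_gt0 ?Vstar_gt0 // Bmx_gt0 //.
by rewrite /adj branchP.
Qed.

(** The total stiffness of the feeders of load i, by [sum_Dmx] below. *)
Definition Dtot i : R := - BLL g i i * VLstar g i 0 ^+ 2.

Lemma Dtot_gt0 i : 0 < Dtot i.
Proof. by rewrite mulr_gt0 ?exprn_gt0 ?VLstar_gt0 // oppr_gt0 BLL_lt0. Qed.

Lemma sum_Dmx i : \sum_(e : edge | feeds e i) Dmx g e e = Dtot i.
Proof.
pose F j := Vstar g j 0 * VLstar g i 0 * Bmx g j (ld i).
transitivity (\sum_(e : edge | feeds e i) F (snd_end e)).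
  apply: eq_bigr => e; rewrite feedsE Dmx_diagE => /eqP ->.
  by rewrite Vstar_load.
rewrite sum_feeds /Dtot expr2 mulrA VLstar_eq mulr_suml.
apply: eq_bigr => k _; rewrite /F Vstar_gen Bmx_sym; ring.
Qed.

Lemma Smx_entry i j :
  Smx g i j = 4^-1 * (VLstar g i 0 * BLL g i j * VLstar g j 0).
Proof. by rewrite /Smx mul_mx_diag mul_diag_mx !mxE. Qed.

Lemma Smx_diag : is_diag_mx (Smx g).
Proof.
apply/is_diag_mxP => i j ij.
by rewrite Smx_entry BLL_off ?mulr0 ?mul0r ?mulr0 // -val_eqE.
Qed.

Lemma SmxE i : Smx g i i = - Dtot i / 4.
Proof. by rewrite Smx_entry /Dtot; field. Qed.

Lemma Delta_ge0 i : 0 <= Delta g i.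
Proof.
rewrite /Delta SmxE mulNr invrN mulrN -mulNr.
by rewrite divr_ge0 ?oppr_ge0 ?(QL_le0 g_valid) // divr_ge0 ?ltW ?Dtot_gt0.
Qed.

Definition weight i (e : edge) : R := Dmx g e e / Dtot i.

Lemma weight_ge0 i e : 0 <= weight i e.
Proof. by rewrite divr_ge0 ?ltW ?Dmx_gt0 ?Dtot_gt0. Qed.

Lemma sum_weight i : \sum_(e : edge | feeds e i) weight i e = 1.
Proof. by rewrite -mulr_suml sum_Dmx divff // gt_eqF ?Dtot_gt0. Qed.

Lemma GammaE_ge0 (e : edge) : 0 <= GammaE e.
Proof. by rewrite divr_ge0 ?normr_ge0 ?ltW ?Dmx_gt0. Qed.

Lemma GammaE_le (e : edge) i : feeds e i -> 0 <= GammaE e <= Gamma g i.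
Proof. by move=> ei; rewrite GammaE_ge0 /Gamma le_bigmax_cond. Qed.

Lemma Gamma_ge0 i : 0 <= Gamma g i.
Proof. by have [e /GammaE_le/andP[]] := feeder_exists i; exact: le_trans. Qed.

Lemma Gamma_const i x :
  (forall e : edge, feeds e i -> GammaE e = x) -> Gamma g i = x.
Proof.
move=> ex; have [e ei] := feeder_exists i; rewrite -(ex e ei).
apply/eqP; rewrite eq_le; have /andP[e0 ->] := GammaE_le ei; rewrite andbT.
by apply: bigmax_le => // e' ei'; rewrite !ex.
Qed.

Lemma ratioK (VL : 'cV[R]_n) i : VL i 0 = ratio g VL i * VLstar g i 0.
Proof. by rewrite divfK // gt_eqF ?VLstar_gt0. Qed.

Lemma cos_sqr (e : edge) (v t : R) : v * sin t = flow g e 0 / Dmx g e e ->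
  (v * cos t) ^+ 2 = v ^+ 2 - GammaE e ^+ 2.
Proof.
have -> : GammaE e ^+ 2 = (flow g e 0 / Dmx g e e) ^+ 2.
  by rewrite [LHS]expr_div_n real_normK ?num_real // -expr_div_n.
move=> <-; have /eqP := cos2Dsin2 t; rewrite eq_sym -subr_eq => /eqP cs.
by rewrite !exprMn -cs; ring.
Qed.

Section Equations.
Hypothesis g_radial : radial g.
Variables (th : 'cV[R]_(n + m)) (VL : 'cV[R]_n).
Local Notation V := (col_mx VL (VG g)).

(** On a tree the nodal balance A q = P determines the branch flows q. *)
Lemma active_branches :
  (forall i, Pinj g i 0 =
    \sum_j V i 0 * V j 0 * Bmx g i j * sin (th i 0 - th j 0)) <->
  (forall e : edge, V (snd_end e) 0 * V (rcv_end e) 0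
    * Bmx g (snd_end e) (rcv_end e) * sin (angle_diff th e) = flow g e 0).
Proof.
pose f i j := V i 0 * V j 0 * Bmx g i j * sin (th i 0 - th j 0).
have fN i j : f i j = - f j i.
  by rewrite /f -mulrN -sinN opprB Bmx_sym [V i 0 * _]mulrC.
have f0 i j : ~~ adj g i j -> f i j = 0.
  have [->|ij] := eqVneq i j; first by rewrite /f subrr sin0 mulr0.
  by move=> nij; rewrite /f Bmx_eq0 // mulr0 mul0r.
have fE i := incidence_mulE g_valid i fN f0.
split=> [act e|br i]; last first.
  rewrite -(incidence_flow g_valid g_radial) -fE; congr ((_ *m _) i 0).
  by apply/colP => e; rewrite [RHS]mxE /f -br sin_princ.
have <- : \col_e f (snd_end e) (rcv_end e) = flow g.
  by apply: flow_unique => //; apply/colP => i; rewrite fE act.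
by rewrite [RHS]mxE /f sin_princ.
Qed.

(** Dividing the reactive power equation of a load by its total stiffness makes
    it a balance between v ^ 2 + Delta / 4 and a convex combination of the
    v * cos (angle) of its feeders. *)
Lemma reactive_load i :
  QL g i 0 =
    - \sum_j V (ld i) 0 * V j 0 * Bmx g (ld i) j * cos (th (ld i) 0 - th j 0) <->
  ratio g VL i ^+ 2 + Delta g i / 4 =
    \sum_(e : edge | feeds e i)
      weight i e * (ratio g VL i * cos (angle_diff th e)).
Proof.
set v := ratio g VL i; set C := (X in _ <-> _ = X).
have -> : \sum_j V (ld i) 0 * V j 0 * Bmx g (ld i) j * cos (th (ld i) 0 - th j 0)
    = Dtot i * (C - v ^+ 2).
  rewrite big_split_ord /= (bigD1 i) //= [X in _ + X + _]big1 ?addr0; last first.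
    move=> j ji; rewrite -BLLE BLL_off 1?eq_sym //; ring.
  have -> : \sum_k V (ld i) 0 * V (gn k) 0 * Bmx g (ld i) (gn k)
      * cos (th (ld i) 0 - th (gn k) 0) = Dtot i * C.
    pose F j :=
      Bmx g j (ld i) * Vstar g j 0 * VLstar g i 0 * v * cos (th j 0 - th (ld i) 0).
    transitivity (\sum_(e : edge | feeds e i) F (snd_end e)).
      rewrite sum_feeds [RHS]big_mkcond; apply: eq_bigr => k _.
      case: ifPn => [_|]; last first.
        rewrite -adj_load_gen => nk; rewrite Bmx_eq0 ?eq_lrshift //; ring.
      rewrite /F col_mxEu col_mxEd Vstar_gen Bmx_sym -cosN opprB (ratioK VL i) -/v.
      ring.
    rewrite mulr_sumr; apply: eq_bigr => e; rewrite feedsE /angle_diff => /eqP re.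
    rewrite cos_princ re /F /weight Dmx_diagE re Vstar_load.
    by field; rewrite gt_eqF ?Dtot_gt0.
  rewrite subrr cos0 -BLLE !col_mxEu (ratioK VL i) -/v /Dtot; ring.
have D0 : Dtot i != 0 by rewrite gt_eqF ?Dtot_gt0.
have -> : Delta g i = - 4 * (QL g i 0 / Dtot i) by rewrite /Delta SmxE; field.
split=> [->|eq]; first by field.
have -> : C = v ^+ 2 - QL g i 0 / Dtot i by rewrite -eq; field.
by field.
Qed.

(** The decoupled form of the power flow equations: each load contributes one
    scalar problem that involves its own voltage and feeder angles only, and each
    branch between generators contributes one equation for its own angle. *)
Lemma pf_solutionP : pf_solution g th VL <->
  [/\ forall i, balanced (fun e => feeds e i) (weight i) (@GammaE _ _ _ g)
         (Delta g i) (ratio g VL i)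
         (fun e => ratio g VL i * cos (angle_diff th e)),
      forall (e : edge) i, feeds e i ->
        ratio g VL i * sin (angle_diff th e) = flow g e 0 / Dmx g e e
    & forall e : edge, gen_gen e ->
        sin (angle_diff th e) = flow g e 0 / Dmx g e e].
Proof.
have D0 (e : edge) : Dmx g e e != 0 by rewrite gt_eqF ?Dmx_gt0.
have loadE (e : edge) i : feeds e i -> V (snd_end e) 0 * V (rcv_end e) 0
    * Bmx g (snd_end e) (rcv_end e) = ratio g VL i * Dmx g e e.
  rewrite feedsE Dmx_diagE => /eqP ->; have [k ->] := snd_end_gen e.
  by rewrite Vstar_gen Vstar_load col_mxEu col_mxEd (ratioK VL i); ring.
have genE (e : edge) : gen_gen e -> V (snd_end e) 0 * V (rcv_end e) 0
    * Bmx g (snd_end e) (rcv_end e) = Dmx g e e.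
  rewrite gen_genE Dmx_diagE; case: (split_ordP (rcv_end e)) => [j ->|k' -> _].
    by rewrite is_load_lshift.
  by have [k ->] := snd_end_gen e; rewrite !Vstar_gen !col_mxEd.
split=> [[V0 /active_branches act re]|[bal fd gg]].
  have fd (e : edge) i : feeds e i ->
      ratio g VL i * sin (angle_diff th e) = flow g e 0 / Dmx g e e.
    by move=> ei; rewrite -act (loadE _ _ ei); field.
  split=> // [i|e egg]; last by rewrite -act genE //; field.
  split=> [|e ei|]; first by rewrite divr_gt0 ?VLstar_gt0.
    by apply: cos_sqr; exact: fd.
  exact/reactive_load.
split=> [i||i].
- by have [v0 _ _] := bal i; rewrite (ratioK VL i) mulr_gt0 ?VLstar_gt0.
- apply/active_branches => e; have [[i ei]|egg] := edge_cases e.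
    by rewrite (loadE _ _ ei) mulrAC fd //; field.
  by rewrite genE // gg //; field.
- by apply/reactive_load; have [] := bal i.
Qed.

End Equations.
End Reduction.

(** * Solutions of the power flow equations *)

Section Solutions.
Context {R : realType} {n m : nat} (g : grid R n m).
Hypothesis g_valid : valid g.
Hypothesis g_radial : radial g.
Hypothesis g_noll : no_load_load g.

Local Notation edge := 'I_#|branches g|.

Let wge0 i (e : edge) (_ : feeds e i) : 0 <= weight i e :=
  weight_ge0 g_valid g_noll i e.
Let wsum := sum_weight g_valid g_noll.
Let hle i (e : edge) (ei : feeds e i) := GammaE_le g_valid g_noll ei.
Let D0 := Delta_ge0 g_valid g_noll.
Let G0 := Gamma_ge0 g_valid g_noll.
Let pfP := pf_solutionP g_valid g_noll g_radial.

Lemma condC_ranges : condC g -> ranges g.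
Proof.
move=> [Cl Cg]; split=> [i|e egg].
  have [q01 q4] := angle_lt_pi4 (D0 i) (G0 i) (Cl i).
  split; [exact: highv_itv|exact: lowv_itv|by rewrite asin_ge0|].
  rewrite asinK // in_itv /=; case/andP: q01 => q0 ->.
  by rewrite (le_trans _ q0) // oppr_le0.
have h1 := Cg e egg; have h0 := GammaE_ge0 g_valid g_noll e.
split; first by apply: asin_lt_pihalf; rewrite h0.
by rewrite asinK // norm_le1_itv // ger0_norm // ltW.
Qed.

(** Within [-pi/2, pi/2] an angle is determined by its sine, and the sines are
    determined by the flows and the voltages.  So the angle differences agree
    modulo 2 pi on every branch, and the common rotation propagates through the
    connected grid. *)
Lemma same_stateP th th' VL : pf_solution g th VL -> pf_solution g th' VL ->
    (forall e : edge, `|angle_diff th e| <= pi / 2) ->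
    (forall e : edge, `|angle_diff th' e| <= pi / 2) ->
  same_state th VL th' VL.
Proof.
move=> /pfP[bal fd gg] /pfP[_ fd' gg'] a a'.
have eq_angle (e : edge) : angle_diff th e = angle_diff th' e.
  apply: sin_inj; [exact: angle_itv|exact: angle_itv|].
  have [[i ei]|egg] := edge_cases g_valid g_noll e; last by rewrite gg // gg'.
  have [v0 _ _] := bal i; apply: (mulfI (lt0r_neq0 v0)).
  by rewrite (fd e i ei) (fd' e i ei).
split=> //; pose i0 : 'I_(n + m) := rshift n (Ordinal (gen_exists g_valid)).
exists (th' i0 0 - th i0 0).
apply: (connected_ind (i0 := i0) g_valid).
  by exists 0; rewrite mulr0 addr0 addrC subrK.
have step (e : edge) : exists k : int,
    th' (snd_end e) 0 - th (snd_end e) 0 =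
    th' (rcv_end e) 0 - th (rcv_end e) 0 + 2 * pi * k%:~R.
  have := eq_angle e; rewrite /angle_diff /princ.
  set k := Num.ceil _; set k' := Num.ceil _ => h.
  by exists (k' - k); rewrite intrB; lra.
move=> i j ij [k ki].
move: ij; rewrite /adj => /orP[]/branch_index[e [si rj]];
  have [k' h] := step e; rewrite si rj in h.
  by exists (k - k'); rewrite intrB; lra.
by exists (k + k'); rewrite intrD; lra.
Qed.

Lemma bounds_angle th VL : condC g -> boundsB g th VL ->
  forall e : edge, `|angle_diff th e| < pi / 2.
Proof.
move=> C [_ bl bg] e; have [rl rg] := condC_ranges C.
have pi0 := pi_gt0 R.
have [[i ei]|egg] := edge_cases g_valid g_noll e.
  have [_ _ /andP[_ lt4] _] := rl i; apply: le_lt_trans (bl e i ei) _.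
  by apply: lt_trans lt4 _; lra.
by have [/andP[_ ?] _] := rg e egg; apply: le_lt_trans (bg e egg) _.
Qed.

(** Each load is solved separately, the angles are then the arcsines of the
    prescribed sines, and the tree carries them to bus angles. *)
Lemma solution_exists : condC g ->
  exists th VL, pf_solution g th VL /\ boundsB g th VL.
Proof.
move=> C; have [Cl Cg] := C.
have /choice[v hv] i :=
  balanced_exists (@wge0 i) (wsum i) (@hle i) (D0 i) (G0 i) (Cl i).
pose VL : 'cV[R]_n := \col_i (v i * VLstar g i 0).
(* Relative voltages of the buses: 1 at the generators. *)
pose u : 'cV[R]_(n + m) := col_mx (\col_i v i) (const_mx 1).
pose x (e : edge) := flow g e 0 / Dmx g e e / u (rcv_end e) 0.
have rE i : ratio g VL i = v i.
  by rewrite /ratio mxE mulfK // gt_eqF ?(VLstar_gt0 g_valid g_noll).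
have v0 i : 0 < v i by have [_ []] := hv i.
have ul (e : edge) i : feeds e i -> u (rcv_end e) 0 = v i.
  by rewrite (feedsE g_valid g_noll) => /eqP ->; rewrite col_mxEu mxE.
have ug (e : edge) : gen_gen e -> u (rcv_end e) 0 = 1.
  rewrite (gen_genE g_valid g_noll); case: (split_ordP (rcv_end e)) => [j ->|k ->].
    by rewrite is_load_lshift.
  by rewrite col_mxEd mxE.
have xn (e : edge) : 0 < u (rcv_end e) 0 -> `|x e| = GammaE e / u (rcv_end e) 0.
  move=> u0; rewrite /x !normrM !normfV (gtr0_norm u0).
  by rewrite (gtr0_norm (Dmx_gt0 g_valid g_noll e)).
have xl (e : edge) i : feeds e i -> `|x e| <= Gamma g i / vplus g i <= 1.
  move=> ei; have [/andP[q0 q1] _] := angle_lt_pi4 (D0 i) (G0 i) (Cl i).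
  rewrite [X in _ && X]q1 andbT xn (ul _ _ ei) //.
  have /andP[h0 hG] := hle ei; have [/andP[hv1 _] _] := hv i.
  have /andP[hp _] := highv_itv (D0 i) (Cl i).
  have hp0 : 0 < vplus g i by apply: lt_trans hp; rewrite invr_gt0.
  by rewrite ler_pM ?invr_ge0 ?(ltW (v0 i)) // lef_pV2 ?posrE.
have xg (e : edge) : gen_gen e -> `|x e| = GammaE e.
  by move=> egg; rewrite xn ug // divr1.
have x1 (e : edge) : `|x e| <= 1.
  have [[i ei]|egg] := edge_cases g_valid g_noll e.
    by have /andP[] := xl e i ei; exact: le_trans.
  by rewrite xg // ltW // Cg.
have [th thE] := potential g_valid g_radial (fun e => asin (x e)).
have aE (e : edge) : angle_diff th e = asin (x e).
  by rewrite /angle_diff thE princ_id // norm_asin_le.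
have sE (e : edge) : sin (angle_diff th e) = x e.
  by rewrite aE asinK // norm_le1_itv.
have fd (e : edge) i : feeds e i ->
    v i * sin (angle_diff th e) = flow g e 0 / Dmx g e e.
  by move=> ei; rewrite sE /x (ul _ _ ei) mulrC divfK // gt_eqF.
exists th, VL; split.
  apply/pfP; split=> [i|e i ei|e egg]; rewrite ?rE; last 2 first.
  - exact: fd.
  - by rewrite sE /x ug // divr1.
  have [_ [_ _ bal]] := hv i; split=> // [e ei|]; first by apply: cos_sqr; exact: fd.
  rewrite bal; apply: eq_bigr => e ei; congr (_ * _).
  rewrite -(cos_sqr (fd e i ei)) sqrtr_sqr ger0_norm // mulr_ge0 ?(ltW (v0 i)) //.
  by rewrite aE cos_ge0_norm // norm_asin_le.
split=> [i|e i ei|e egg]; rewrite ?rE; first by have [] := hv i.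
  rewrite aE norm_asin //; have /andP[xG G1] := xl e i ei.
  exact: le_asin.
by rewrite aE norm_asin // xg.
Qed.

Lemma solution_unique : condC g ->
  has_unique (fun th VL => pf_solution g th VL /\ boundsB g th VL).
Proof.
move=> C; split; first exact: solution_exists.
have [Cl Cg] := C.
move=> th VL th' VL' [pf bB] [pf' bB'].
have a e := ltW (bounds_angle C bB e); have a' e := ltW (bounds_angle C bB' e).
have /pfP[bal _ _] := pf; have /pfP[bal' _ _] := pf'.
have [br _ _] := bB; have [br' _ _] := bB'.
suff VLE : VL = VL' by rewrite -VLE in pf' *; exact: same_stateP.
apply/colP => i; rewrite (ratioK g_valid g_noll VL) (ratioK g_valid g_noll VL').
congr (_ * _); have [v0 _ _] := bal i; have [v0' _ _] := bal' i.
have /andP[vi _] := br i; have /andP[vi' _] := br' i.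
apply: (balanced_unique (@wge0 i) (wsum i) (@hle i) (D0 i) (Cl i)
  (bal i) _ vi (bal' i) _ vi').
  by move=> e _; rewrite mulr_ge0 ?(ltW v0) // cos_ge0_norm.
by move=> e _; rewrite mulr_ge0 ?(ltW v0') // cos_ge0_norm.
Qed.

Lemma extra_high_voltage_excluded : no_extra_high_voltage g.
Proof.
move=> [th [VL [i [/pfP[bal _ _]]]]]; rewrite ltNge.
by rewrite (balanced_le1 (@wge0 i) (wsum i) (@hle i) (D0 i) (bal i)).
Qed.

Lemma feeder_unique i (e e' : edge) :
  #|PV g i| = 1%N -> feeds e i -> feeds e' i -> e = e'.
Proof.
move=> /eqP/cards1P[k PVk]; rewrite !(feedsE g_valid g_noll) => /eqP ri /eqP ri'.
have sk (e1 : edge) : rcv_end e1 = lshift m i -> snd_end e1 = rshift n k.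
  move=> r1; have [k1 s1] := snd_end_gen g_valid g_noll e1.
  have : k1 \in PV g i by rewrite inE -s1 -r1 branchP.
  by rewrite PVk inE s1 => /eqP ->.
by apply: branch_inj; rewrite ?sk ?ri ?ri'.
Qed.

(** A load with a single feeder satisfies v ^ 2 + Delta / 4 = c for the c of
    that feeder, which is therefore nonnegative without an assumption on the
    angle. *)
Lemma medium_voltage_excluded : condC g -> no_medium_voltage g.
Proof.
move=> [Cl _] [th [VL [i [/pfP[bal _ _] reg]]]].
have [v0 c2 b] := bal i.
apply: (balanced_gap (@wge0 i) (wsum i) (@hle i) (D0 i) (Cl i) (bal i)).
case: reg => [one e ei|reg e ei]; last first.
  by rewrite mulr_ge0 ?(ltW v0) // cos_ge0_norm ?reg.
have sum1 (F : edge -> R) : \sum_(e' : edge | feeds e' i) F e' = F e.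
  apply: big_pred1 => e'; apply/idP/eqP => [ei'|->//].
  exact: feeder_unique ei' ei.
have := wsum i; rewrite sum1 => w1; rewrite sum1 w1 mul1r in b.
by rewrite -b addr_ge0 ?sqr_ge0 // divr_ge0.
Qed.

(** Common source of all the necessity claims.  When the feeders of each load are
    equally stressed, [uniform_high] pins every high-voltage solution to v_+ and
    yields the strict condition, while [uniform_weak] yields the weak one from
    any solution. *)
Lemma uniform_sharp : (forall (e : edge) i, feeds e i -> GammaE e = Gamma g i) ->
  condC_sharp g.
Proof.
move=> un.
have hvP th VL : hv_solution g th VL ->
    [/\ condC g, forall i, ratio g VL i = vplus g i & boundsB_eq g th VL].
  move=> [/pfP[bal fd gg] lo a].
  have high i : Delta g i + 4 * Gamma g i ^+ 2 < 1 /\ ratio g VL i = vplus g i.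
    apply: (uniform_high (@wge0 i) (wsum i) (D0 i) (fun e => un e i) (bal i)
      _ (lo i)) => e _.
    by have [v0 _ _] := bal i; rewrite mulr_ge0 ?(ltW v0) // cos_ge0_norm ?ltW.
  have sn (e : edge) (v : R) : 0 < v ->
      v * sin (angle_diff th e) = flow g e 0 / Dmx g e e ->
      `|sin (angle_diff th e)| = GammaE e / v.
    move=> v0 /(congr1 (fun y => `|y| / v)).
    rewrite !normrM (gtr0_norm v0) mulrC mulKf ?gt_eqF // => ->.
    by rewrite normfV (gtr0_norm (Dmx_gt0 g_valid g_noll e)).
  have sgg (e : edge) : gen_gen e -> `|sin (angle_diff th e)| = GammaE e.
    by move=> egg; rewrite (@sn e 1) ?mul1r ?divr1 // gg.
  split; [split=> [i|e egg]| |split=> [i|e i ei|e egg]].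
  - by have [] := high i.
  - by rewrite -sgg // sin_lt1.
  - by move=> i; have [] := high i.
  - by have [] := high i.
  - have [v0 _ _] := bal i; rewrite norm_angleE ?ltW // (sn e _ v0) ?fd //.
    by rewrite (un e i ei) (high i).2.
  - by rewrite norm_angleE ?ltW // sgg.
have hvB th VL : hv_solution g th VL -> boundsB g th VL /\ boundsB_eq g th VL.
  move=> h; have [C _ B] := hvP _ _ h; have [b1 b2 b3] := B; split=> //.
  split=> [i|e i ei|e egg]; rewrite ?b1 ?(b2 e i) ?b3 ?lexx //=.
  by have [rl _] := condC_ranges C; have [/andP[]] := rl i.
have hvE : condC g -> exists th VL, hv_solution g th VL.
  move=> C; have [th [VL [pf B]]] := solution_exists C; exists th, VL.
  split=> // [i|]; last exact: bounds_angle B.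
  have [br _ _] := B; have /andP[lo _] := br i; have [Cl _] := C.
  exact: lt_le_trans (lowv_lt_highv (D0 i) (Cl i)) lo.
split.
- split=> [C|[[th [VL h]] _]]; last by have [] := hvP _ _ h.
  split; first exact: hvE.
  move=> th VL th' VL' h h'; have [_ r _] := hvP _ _ h; have [_ r' _] := hvP _ _ h'.
  have VLE : VL = VL'.
    apply/colP => i; rewrite (ratioK g_valid g_noll VL) (ratioK g_valid g_noll VL').
    by rewrite r r'.
  rewrite -VLE in h' *; have [pf _ a] := h; have [pf' _ a'] := h'.
  by apply: same_stateP => // e; exact: ltW.
- by split=> [/hvE//|[th [VL h]]]; have [] := hvP _ _ h.
- move=> [th [VL /pfP[bal _ gg]]]; split=> [i|e egg].
    exact: (uniform_weak (@wge0 i) (wsum i) (D0 i) (fun e => un e i) (bal i)).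
  have -> : GammaE e = `|sin (angle_diff th e)|.
    by rewrite gg // normrM normfV (gtr0_norm (Dmx_gt0 g_valid g_noll e)).
  by rewrite ler_norml sin_geN1 sin_le1.
- exact: hvB.
Qed.

Lemma single_feeder_uniform : (forall i : 'I_n, #|PV g i| = 1%N) ->
  forall (e : edge) i, feeds e i -> GammaE e = Gamma g i.
Proof.
move=> one e i ei; symmetry; apply: (Gamma_const g_valid g_noll) => e' ei'.
by rewrite (feeder_unique (one i) ei' ei).
Qed.

Lemma GammaE_profile (x : R) (q : 'cV[R]_#|branches g|) :
  Pinj g = x *: (incidence g *m (Dmx g *m q)) ->
  forall e : edge, GammaE e = `|x * q e 0|.
Proof.
move=> Px e; rewrite /GammaE; have <- : x *: (Dmx g *m q) = flow g.
  by apply: (flow_unique g_valid g_radial); rewrite -scalemxAr.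
have -> : (x *: (Dmx g *m q)) e 0 = x * q e 0 * Dmx g e e.
  by rewrite mul_diag_mx !mxE eqxx mulr1n; ring.
have d0 := Dmx_gt0 g_valid g_noll e.
by rewrite normrM (gtr0_norm d0) mulfK // gt_eqF.
Qed.

(** In each profile the stress of a branch depends only on whether it ends at a
    load, so [uniform_sharp] applies. *)
Lemma profile_sharp (a : R) : 0 <= a ->
    profile_Q g a \/ profile_gl g a \/ profile_gg g a ->
  (a < 1 -> condC g) /\ condC_sharp g.
Proof.
move=> a0 prof.
suff [gl [gg [D [GE DE lt]]]] : exists gl gg D : R,
    [/\ forall e : edge, GammaE e = if gen_load e then gl else gg,
        forall i, Delta g i = D
      & a < 1 -> D + 4 * gl ^+ 2 < 1 /\ gg < 1].
  have Ggl i : Gamma g i = gl.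
    apply: (Gamma_const g_valid g_noll) => e /andP[el _]; by rewrite GE el.
  split; last by apply: uniform_sharp => e i ei; rewrite Ggl GE; case/andP: ei => ->.
  move=> a1; have [lt1 lt2] := lt a1.
  split=> [i|e]; first by rewrite DE Ggl.
  by rewrite GE (gen_genE g_valid g_noll) (gen_loadE g_valid g_noll) => /negPf->.
have DQ0 : QL g = 0 -> forall i, Delta g i = 0.
  by move=> Q0 i; rewrite /Delta Q0 mxE mul0r.
case: prof => [[QE P0]|[[Q0 PE]|[Q0 PE]]].
- exists 0, 0, a; split=> [e|i|a1]; last by split; [lra|exact: ltr01].
    rewrite (@GammaE_profile 0 0) ?scale0r //.
    by rewrite mul0r normr0 if_same.
  have S0 : Smx g i i != 0.
    rewrite SmxE mulNr oppr_eq0 mulf_neq0 ?invr_eq0 // gt_eqF //.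
    exact: Dtot_gt0.
  rewrite /Delta; have -> : QL g i 0 = a * Smx g i i.
    rewrite QE mxE; congr (_ * _); rewrite mxE (bigD1 i) //= big1 ?addr0.
      by rewrite [const_mx _ _ _]mxE mulr1.
    move=> j ji; have /is_diag_mxP/(_ i j) := Smx_diag g_valid g_noll.
    by rewrite -(inj_eq val_inj) eq_sym in ji; move=> -> //; rewrite mul0r.
  by rewrite mulfK.
- exists (a / 2), 0, 0; split=> [e|i|a1]; [|exact: DQ0|by split; [nra|exact: ltr01]].
  rewrite (GammaE_profile PE) mxE; case: ifP => _.
    by rewrite mulr1 ger0_norm // divr_ge0.
  by rewrite mulr0 normr0.
exists 0, a, 0; split=> [e|i|a1]; [|exact: DQ0|by split=> //; lra].
rewrite (GammaE_profile PE) mxE (gen_genE g_valid g_noll).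
rewrite (gen_loadE g_valid g_noll); case: ifP => _ /=.
  by rewrite mulr0 normr0.
by rewrite mulr1 ger0_norm.
Qed.

End Solutions.

Theorem theoremV1 (R : realType) (n m : nat) (g : grid R n m)
    (g_valid : valid g) (g_radial : radial g) (g_noll : no_load_load g) :
  [/\ is_diag_mx (Smx g),
      condC g ->
        [/\ ranges g,
            has_unique (fun th VL => pf_solution g th VL /\ boundsB g th VL),
            no_medium_voltage g
          & no_extra_high_voltage g],
      (forall i : 'I_n, #|PV g i| = 1%N) -> condC_sharp g
    & forall a : R, 0 <= a ->
        profile_Q g a \/ profile_gl g a \/ profile_gg g a ->
        (a < 1 -> condC g) /\ condC_sharp g].
Proof.
split.
- exact: Smx_diag.
- move=> C; split.
  + exact: condC_ranges.
  + exact: solution_unique.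
  + exact: medium_voltage_excluded.
  + exact: extra_high_voltage_excluded.
- by move=> one; apply: uniform_sharp => //; exact: single_feeder_uniform.
- by move=> a a0 prof; exact: profile_sharp.
Qed.
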